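(* Let the sequence $(x^k,y^k,\xi^k)_{k\ge0}$ be generated either by the RVOS algorithm or by the ARVOS algorithm (both described in the context). Then $\xi^k>0$ for all $k\ge0$. Furthermore, both algorithms are unconditionally energy stable in the sense that the modified pseudo-energy is nonincreasing: $$\tilde{\mathcal E}^{k+1}\le\tilde{\mathcal E}^{k}\le\cdots\le\tilde{\mathcal E}^{0},\qquad k\ge0,$$ where $\tilde{\mathcal E}^{k+1}:=\xi^{k+1}\mathcal E(x^k,y^k)$ is nonnegative for all $k\ge0$.
   Context: $\mathbb R^N$ carries the standard inner product and norm $\|\cdot\|$. The function $f:\mathbb R^N\to\mathbb R$ is differentiable and has a minimizer. The pseudo-energy is $\mathcal E(x,y):=f(x)+\frac12\|y-x\|^2$. Standing assumption: $\mathcal E(x,y)>0$ for all $x,y$ (equivalently $f>0$ everywhere). The damping coefficients satisfy $\eta^k>0$ for all $k\ge1$, and it is assumed that, at every step $k$ with the time step $\Delta t$ used in that step, $\frac1{\Delta t}+\Delta t+(1-\Delta t)\eta^{k+1}\ne0$, so that the algorithms are well defined. RVOS algorithm. Inputs: $x^0,y^0\in\mathbb R^N$, $\Delta t>0$, $\xi^0=1$. Set $x^{-1}=x^0$, $y^{-1}=y^0$, $v^0=y^0-x^0$, and write $\mathcal E^k:=\mathcal E(x^k,y^k)$ for $k\ge-1$. For $k=0,1,2,\dots$: (1) $z^{k+1}=\dfrac{1}{\frac1{\Delta t}+\Delta t+(1-\Delta t)\eta^{k+1}}\left(\dfrac{v^k}{\Delta t}-(1-\Delta t)\nabla f(x^k)\right)$;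 (2) if $\|z^{k+1}\|\ne0$, $\widetilde\xi^{k+1}=\dfrac{-\frac{\mathcal E^k}{\Delta t}+\sqrt{\left(\frac{\mathcal E^k}{\Delta t}\right)^2+4\eta^{k+1}\|z^{k+1}\|^2\frac{\xi^k\mathcal E^{k-1}}{\Delta t}}}{2\eta^{k+1}\|z^{k+1}\|^2}$; otherwise $\widetilde\xi^{k+1}=\dfrac{\xi^k\mathcal E^{k-1}}{\mathcal E^k}$; (3) $y^{k+1}=y^k+\Delta t\left((1-\eta^{k+1})z^{k+1}\widetilde\xi^{k+1}-\widetilde\xi^{k+1}\nabla f(x^k)\right)$; (4) $x^{k+1}=x^k+(1-\widetilde\xi^{k+1})(y^k-x^k)+\Delta t\left(z^{k+1}\widetilde\xi^{k+1}+y^{k+1}-y^k\right)$; (5) $v^{k+1}=y^{k+1}-x^{k+1}$; (6) $\xi^{k+1}=\min\left\{\dfrac{\xi^k\mathcal E^{k-1}}{\mathcal E^k},\dfrac{\mathcal E^{k+1}}{\mathcal E^k}\right\}$. ARVOS algorithm. Inputs: $x^0,y^0\in\mathbb R^N$, $\Delta t^0>0$, $\xi^0=1$, and constants $\rho>1$, $\gamma>0$, $\Delta t_{\min}>0$; initialization as in RVOS. For $k=0,1,2,\dots$: if $\xi^k<\gamma$ and $\Delta t^k>\Delta t_{\min}$, set $\Delta t^{k+1}=\max\{\xi^k\Delta t^k,\Delta t_{\min}\}$; otherwise set $\Delta t^{k+1}=\rho\,\Delta t^k$. Then perform steps (1)–(6) of RVOS with $\Delta t=\Delta t^{k+1}$.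 The modified pseudo-energy is $\tilde{\mathcal E}^{k+1}:=\xi^{k+1}\mathcal E^k$ for $k\ge-1$; in particular $\tilde{\mathcal E}^0=\xi^0\mathcal E^{-1}=\mathcal E(x^0,y^0)$. *)

(* Defs.v *)
From mathcomp Require Import all_boot all_order all_algebra.
From mathcomp Require Import all_classical all_reals all_analysis.

Set Implicit Arguments.
Unset Strict Implicit.
Unset Printing Implicit Defensive.

Import Order.TTheory GRing.Theory Num.Theory.
Import numFieldNormedType.Exports.

Local Open Scope ring_scope.

Section Euclidean.
Context {R : realType} {N : nat}.
Implicit Types (f : 'rV[R]_N -> R) (u v x : 'rV[R]_N).

Definition dot u v : R := \sum_(i < N) u 0 i * v 0 i.

(* The library norm `|u| on matrices is the sup norm, hence a separate
   Euclidean norm. *)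
Definition enorm u : R := Num.sqrt (dot u u).

Definition grad f x : 'rV[R]_N := \row_(i < N) 'D_(delta_mx 0 i) f x.

Definition has_minimizer f : Prop := exists xm, forall x, f xm <= f x.

End Euclidean.

Section Algorithms.
Context {R : realType} {N : nat}.
Variables (f : 'rV[R]_N -> R) (eta : nat -> R).

Definition pseudo_energy (x y : 'rV[R]_N) : R :=
  f x + 2^-1 * enorm (y - x) ^+ 2.

(* The denominator of z^{k+1}, with [dt] the time step of that step and
   [e] = eta^{k+1}. *)
Definition step_den (dt e : R) : R := dt^-1 + dt + (1 - dt) * e.

Section Iterates.
Variables (x y v : nat -> 'rV[R]_N) (xi : nat -> R).

Definition energy_at (k : nat) : R := pseudo_energy (x k) (y k).

(* E^{k-1}, for k >= 0: since x^{-1} = x^0 and y^{-1} = y^0, the truncated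
   predecessor gives E^{-1} = E(x^0, y^0) at k = 0. *)
Definition energy_before (k : nat) : R := energy_at k.-1.

(* \tilde E^k = xi^k E^{k-1} for k >= 0, hence
   \tilde E^{k+1} = xi^{k+1} E(x^k, y^k). *)
Definition modified_energy (k : nat) : R := xi k * energy_before k.

Definition init : Prop := v 0%N = y 0%N - x 0%N /\ xi 0%N = 1.

Definition z_next (dt : R) (k : nat) : 'rV[R]_N :=
  (step_den dt (eta k.+1))^-1 *:
    (dt^-1 *: v k - (1 - dt) *: grad f (x k)).

Definition xi_tilde (dt : R) (k : nat) : R :=
  let a := energy_at k / dt in
  let b := eta k.+1 * enorm (z_next dt k) ^+ 2 in
  if enorm (z_next dt k) != 0 then
    (- a + Num.sqrt (a ^+ 2 + 4 * b * (xi k * energy_before k / dt)))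
      / (2 * b)
  else xi k * energy_before k / energy_at k.

Definition rvos_step (dt : R) (k : nat) : Prop :=
  let z := z_next dt k in
  let s := xi_tilde dt k in
  [/\ y k.+1 = y k + dt *: (((1 - eta k.+1) * s) *: z - s *: grad f (x k)),
      x k.+1 = x k + (1 - s) *: (y k - x k)
               + dt *: (s *: z + (y k.+1 - y k)),
      v k.+1 = y k.+1 - x k.+1 &
      xi k.+1 = Num.min (xi k * energy_before k / energy_at k)
                        (energy_at k.+1 / energy_at k)].

Definition generated_by_rvos (dt : R) : Prop :=
  [/\ 0 < dt,
      forall k, step_den dt (eta k.+1) != 0,
      init & forall k, rvos_step dt k].

Definition arvos_dt (rho gamma dtmin dtk xik : R) : R :=
  if (xik < gamma) && (dtmin < dtk) then Num.max (xik * dtk) dtmin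
  else rho * dtk.

Definition generated_by_arvos (rho gamma dtmin : R) (dt : nat -> R) : Prop :=
  [/\ [/\ 1 < rho, 0 < gamma, 0 < dtmin & 0 < dt 0%N],
      forall k, step_den (dt k.+1) (eta k.+1) != 0,
      init,
      forall k, dt k.+1 = arvos_dt rho gamma dtmin (dt k) (xi k) &
      forall k, rvos_step (dt k.+1) k].

End Iterates.
End Algorithms.

(* Main.v *)
Require Import Defs.
From mathcomp Require Import all_boot all_order all_algebra.
From mathcomp Require Import all_classical all_reals all_analysis.
Import Order.TTheory GRing.Theory Num.Theory.
Import numFieldNormedType.Exports.
Local Open Scope ring_scope.

(** Stability is built into the relaxation step.  Multiplying
      xi^{k+1} = min (xi^k E^{k-1} / E^k) (E^{k+1} / E^k)
    by E^k > 0 gives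
      xi^{k+1} E^k = min (xi^k E^{k-1}) E^{k+1},
    so the modified energy decays at every step, for every value of the time
    step and of the damping; and xi^{k+1} is the minimum of two quotients of
    positive numbers as soon as xi^k is positive.  RVOS and ARVOS differ only
    in the choice of the time step, on which this update does not depend, so
    [relaxed_xi] isolates what they share and both conclusions are drawn from
    it ([relaxed_xi_gt0], [relaxed_modified_energy_noninc]). *)

Section Relaxation.
Context {R : realType} {N : nat}.
Variables (f : 'rV[R]_N -> R) (x y : nat -> 'rV[R]_N) (xi : nat -> R).

Local Notation E := (energy_at f x y).
Local Notation Eprev := (energy_before f x y).

Definition relaxed_xi : Prop :=
  xi 0%N = 1 /\
  forall k, xi k.+1 = Num.min (xi k * Eprev k / E k) (E k.+1 / E k).

Hypothesis energy_gt0 : forall p q, 0 < pseudo_energy f p q.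
Hypothesis xi_relaxed : relaxed_xi.

Lemma relaxed_xi_gt0 k : 0 < xi k.
Proof.
have [xi0 xiS] := xi_relaxed.
elim: k => [|k IHk]; first by rewrite xi0 ltr01.
by rewrite xiS lt_min !divr_gt0 ?mulr_gt0 ?energy_gt0.
Qed.

(** The first argument of the minimum is exactly the value of xi^{k+1} that
    would conserve the modified energy; the minimum can only lower it. *)
Lemma relaxed_modified_energy_noninc :
  nonincreasing_seq (modified_energy f x y xi).
Proof.
have [_ xiS] := xi_relaxed.
apply/nonincreasing_seqP => k.
rewrite /modified_energy [Eprev k.+1]/(E k) -ler_pdivlMr ?energy_gt0 //.
by rewrite xiS ge_min lexx.
Qed.

End Relaxation.

Lemma rvos_relaxed_xi {R : realType} {N : nat} (f : 'rV[R]_N -> R)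
    (eta : nat -> R) (x y v : nat -> 'rV[R]_N) (xi dt : nat -> R) :
  init x y v xi -> (forall k, rvos_step f eta x y v xi (dt k) k) ->
  relaxed_xi f x y xi.
Proof. by move=> [_ xi0] step; split=> // k; have [] := step k. Qed.

Theorem theorem2p4 (R : realType) (N : nat) (f : 'rV[R]_N -> R)
    (eta : nat -> R) (x y v : nat -> 'rV[R]_N) (xi : nat -> R) :
  (forall p, differentiable f p) ->
  has_minimizer f ->
  (forall p q, 0 < pseudo_energy f p q) ->
  (forall k, (1 <= k)%N -> 0 < eta k) ->
  ((exists dt : R, generated_by_rvos f eta x y v xi dt) \/
   (exists (rho gamma dtmin : R) (dt : nat -> R),
      generated_by_arvos f eta x y v xi rho gamma dtmin dt)) ->
  [/\ forall k, 0 < xi k,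
      nonincreasing_seq (modified_energy f x y xi) &
      forall k, 0 <= modified_energy f x y xi k.+1].
Proof.
move=> _ _ energy_gt0 _ gen.
have xi_relaxed : relaxed_xi f x y xi.
  case: gen => [[dt [_ _ start step]]|[rho [gamma [dtmin [dt]]]]].
    exact: (@rvos_relaxed_xi _ _ f eta x y v xi (fun=> dt)).
  move=> [_ _ start _ step].
  exact: (@rvos_relaxed_xi _ _ f eta x y v xi (fun k => dt k.+1)).
have xi_gt0 := relaxed_xi_gt0 f x y xi energy_gt0 xi_relaxed.
split=> // [|k]; first exact: relaxed_modified_energy_noninc.
by rewrite mulr_ge0 // ltW // energy_gt0.
Qed.
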